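(* Let $G=(V,\mathcal E)$ be a (reflexive) oriented graph which is an absolute retract in the category of oriented graphs; that is, for every oriented graph $H$ and every isometry $f$ from $G$ to $H$ there is a homomorphism $g$ from $H$ to $G$ with $g\circ f=\mathrm{id}_V$. Then for all $x,y\in V$ the value $d_G(x,y)$ of the zigzag distance belongs to $\mathbf N(\Lambda^* )$, the MacNeille completion of $\Lambda^*$.
   Context: **Graphs.** All directed graphs are reflexive: a directed graph is a pair $G=(V,\mathcal E)$ with $\mathcal E\subseteq V\times V$ and $(x,x)\in\mathcal E$ for all $x\in V$. It is *oriented* if $(x,y),(y,x)\in\mathcal E$ implies $x=y$. A *homomorphism* from $G$ to $G'$ is a map $V(G)\to V(G')$ sending arcs to arcs (possibly loops). **Words.** $\Lambda^*$ is the set of finite words (including the empty word) over $\Lambda=\{+,-\}$, ordered by the subword ordering: $u\le v$ iff $u$ is obtained from $v$ by deleting some letters. For $u\in\Lambda^*$, $\uparrow u=\{v:u\le v\}$. **Zigzag distance.** For $u=a_0\cdots a_{n-1}\in\Lambda^*$, $Z_u$ is the reflexive oriented graph on $\{0,\dots,n\}$ whose non-loop arcs are $(i,i+1)$ if $a_i=+$ and $(i+1,i)$ if $a_i=-$, for $0\le i\le n-1$. The zigzag distance $d_G(x,y)$ is the set of all words $u\in\Lambda^*$ for which there is a homomorphism from $Z_u$ to $G$ sending $0$ to $x$ and $|u|$ to $y$. An *isometry* from $G$ to $G'$ is a map $f:V(G)\to V(G')$ with $d_{G'}(f(x),f(y))=d_G(x,y)$ for all $x,y\in V(G)$. **MacNeille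 completion.** For $Y\subseteq\Lambda^*$ let $Y^\Delta=\bigcap_{y\in Y}\uparrow y$ (with $\emptyset^\Delta=\Lambda^*$); $\mathbf N(\Lambda^* )=\{Y^\Delta:Y\subseteq\Lambda^*\}$, ordered by reverse inclusion. *)

(* Defs.v *)
From mathcomp Require Import all_boot.
From mathcomp Require Import boolp classical_sets.

Set Implicit Arguments.
Unset Strict Implicit.
Unset Printing Implicit Defensive.

Local Open Scope classical_set_scope.

(* Words over {+, -}: [true] is the letter +, [false] is the letter -.
   The subword ordering is [subseq]. *)
Definition word : Type := seq bool.

Definition upset (u : word) : set word := [set v | subseq u v].

Definition upper_cone (Y : set word) : set word := \bigcap_(y in Y) upset y.

Definition MacNeille : set (set word) := range upper_cone.

Record digraph : Type := Digraph {
  vertex :> Type;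
  arc : vertex -> vertex -> Prop;
  arc_refl : forall x, arc x x
}.

Definition oriented (G : digraph) : Prop :=
  forall x y : G, arc x y -> arc y x -> x = y.

Definition is_hom (G H : digraph) (f : G -> H) : Prop :=
  forall x y : G, arc x y -> arc (f x) (f y).

(* The default value of [nth] is never used: in the second (resp. third)
   disjunct, i (resp. j) is smaller than [size u]. *)
Definition zigzag_arc (u : word) (i j : 'I_(size u).+1) : Prop :=
  [\/ i = j,
      j = i.+1 :> nat /\ nth true u i = true
    | i = j.+1 :> nat /\ nth true u j = false].

Lemma zigzag_arc_refl (u : word) (i : 'I_(size u).+1) : zigzag_arc i i.
Proof. exact: Or31. Qed.

Definition zigzag (u : word) : digraph := Digraph (@zigzag_arc_refl u).

Lemma zigzag_oriented (u : word) : oriented (zigzag u).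
Proof.
move=> i j /= [//|[ij ui]|[ij ui]] [//|[ji uj]|[ji uj]].
- by move: (ltnn i); rewrite {2}ji ij ltnS leqnSn.
- by rewrite ui in uj.
- by rewrite ui in uj.
- by move: (ltnn i); rewrite {2}ij ji ltnS leqnSn.
Qed.

Definition zdist (G : digraph) (x y : G) : set word :=
  [set u | exists h : zigzag u -> G,
     [/\ is_hom h, h (@ord0 (size u)) = x & h (@ord_max (size u)) = y]].

Definition isometry (G H : digraph) (f : G -> H) : Prop :=
  forall x y : G, zdist (f x) (f y) = zdist x y.

(* Absolute retract among oriented graphs; [G] itself is meant to be oriented. *)
Definition absolute_retract (G : digraph) : Prop :=
  forall H : digraph, oriented H ->
  forall f : G -> H, isometry f ->
  exists g : H -> G, is_hom g /\ (forall x : G, g (f x) = x).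

(* Main.v *)
(* In an oriented graph G, a pair p -> q -> p collapses.  The cancellation rule
   "u+v and u-v in d(x,y) imply uv in d(x,y)" would follow from an isometric
   extension of G containing a walk x -u- p, arcs p -> q -> p and a walk
   q -v- y; such an extension is not oriented, but an oriented absolute retract
   G is a retract of each of its isometric extensions H, oriented or not: blow
   up each vertex of H into copies indexed by tags, a tournament on the tags
   orienting the 2-cycles; by Cantor's theorem there are so many tags that any
   homomorphism to G identifies enough copies to descend to H.  Finally, an
   up-set of words satisfying the cancellation rule is an intersection of
   principal up-sets. *)

Require Import Defs.
From mathcomp Require Import all_boot.
From mathcomp Require Import boolp classical_sets.

Set Implicit Arguments.
Unset Strict Implicit.
Unset Printing Implicit Defensive.

Local Open Scope classical_set_scope.

(* [path.arc] from MathComp shadows the arcs of a digraph. *)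
Local Notation arc := Defs.arc.

(** * Cancellative up-sets of words *)

Definition upward_closed (Z : set word) : Prop :=
  forall u v : word, subseq u v -> Z u -> Z v.

Definition cancellative (Z : set word) : Prop :=
  forall u v : word, Z (u ++ true :: v) -> Z (u ++ false :: v) -> Z (u ++ v).

(** The word read when a walk with word [u] is traversed backwards. *)
Definition flip (u : word) : word := rev (map negb u).

Lemma flip_cat (u v : word) : flip (u ++ v) = flip v ++ flip u.
Proof. by rewrite /flip map_cat rev_cat. Qed.

Lemma flip_cons (a : bool) (u : word) : flip (a :: u) = flip u ++ [:: ~~ a].
Proof. by rewrite -cat1s flip_cat. Qed.

Lemma first_occurrence (b : bool) (u : word) : b \in u ->
  exists m v, u = nseq m (~~ b) ++ b :: v.
Proof.
elim: u => // a u IHu; rewrite inE; case: eqVneq => [<- _|ab /= /IHu [m [v ->]]].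
  by exists 0, u.
by exists m.+1, v => /=; congr (_ :: _); case: a b ab {IHu} => [] [].
Qed.

Lemma notin_nseq (b : bool) (u : word) : b \notin u -> u = nseq (size u) (~~ b).
Proof.
elim: u => // a u IHu; rewrite inE negb_or => /andP[ba /IHu {1}->] /=.
by congr (_ :: _); case: a b ba {IHu} => [] [].
Qed.

Lemma subseq_nseq_cons (b : bool) (m : nat) (u v : word) :
  subseq (b :: u) (nseq m (~~ b) ++ b :: v) = subseq u v.
Proof.
elim: m => [|m IHm]; first by rewrite /= eqxx.
by rewrite -IHm /=; case: b {IHm}.
Qed.

(** It suffices to reach [true :: v] and [false :: v]: each absorbs a letter of one power, and the
    other power survives by upward closure, so a double induction applies. *)
Lemma cancel_prefix (Z : set word) : upward_closed Z -> cancellative Z ->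
  forall (m n : nat) (v : word),
  Z (nseq m true ++ v) -> Z (nseq n false ++ v) -> Z v.
Proof.
move=> upZ canZ; elim=> [//|m IHm]; elim=> [//|n IHn] v Zm Zn.
apply: (canZ [::]) => /=.
- apply: (IHm n.+1); first by rewrite -[true :: v]cat1s catA -(nseqD m 1) addn1.
  by apply: upZ Zn; rewrite cat_subseq// subseq_cons.
- apply: IHn; first by apply: upZ Zm; rewrite cat_subseq// subseq_cons.
  by rewrite -[false :: v]cat1s catA -(nseqD n 1) addn1.
Qed.

(** Strong induction on the length of [v]. Some letter [b] occurs in every word of [Z]. If [v] lacks
    it, [[:: b]] separates; otherwise everything up to the first [b] is removed from [v] and from
    the words of [Z]. *)
Lemma separating_lower_bound (v : word) : forall Z : set word,
  upward_closed Z -> cancellative Z -> ~ Z v ->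
  exists w : word, ~~ subseq w v /\ forall z, Z z -> subseq w z.
Proof.
have [n] := ubnP (size v); elim: n v => // n IHn v vn Z upZ canZ Zv.
(* Otherwise Z contains a power of each letter followed by v, hence v. *)
have [b Zb] : exists b : bool, forall m, ~ Z (nseq m (~~ b) ++ v).
  apply: contrapT => nb; apply: Zv.
  have pump b : exists m, Z (nseq m (~~ b) ++ v).
    apply: contrapT => nm; apply: nb; exists b => m Zm; apply: nm.
    by exists m.
  have [m Zm] := pump false; have [k Zk] := pump true.
  exact: cancel_prefix Zm Zk.
have Zin z : Z z -> b \in z.
  move=> Zz; apply: contrapT => /negP /notin_nseq zE.
  apply: (Zb (size z)); apply: upZ Zz.
  by rewrite {1}zE prefix_subseq.
have [/first_occurrence [j [v1 vE]]|bv] := boolP (b \in v); last first.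
  exists [:: b]; split; first by rewrite sub1seq.
  by move=> z /Zin; rewrite sub1seq.
(* The separating word is [b :: w1], with w1 separating v1 from this residual. *)
pose Z1 := [set t | exists m, Z (nseq m (~~ b) ++ b :: t)].
have mono m k t : m <= k -> Z (nseq m (~~ b) ++ b :: t) ->
    Z (nseq k (~~ b) ++ b :: t).
  move=> mk; apply: upZ; rewrite -(subnK mk) nseqD -catA.
  exact: suffix_subseq.
have [|||| w1 [w1v1 w1Z]] := IHn v1 _ Z1.
- by move: vn; rewrite vE size_cat /= addnS !ltnS; apply/leq_trans/leq_addl.
- move=> s t st [m Zm]; exists m; apply: upZ Zm.
  by rewrite cat_subseq//= eqxx.
(* Raising both exponents to their maximum gives the two words the common prefix that cancellation
   requires. *)
- move=> s t [m Zm] [k Zk]; exists (maxn m k).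
  rewrite -[b :: _]cat1s !catA; apply: canZ; rewrite -!catA /=.
    by apply: mono Zm; rewrite leq_maxl.
  by apply: mono Zk; rewrite leq_maxr.
- move=> [m Zm]; apply: (Zb m); apply: upZ Zm.
  by rewrite vE cat_subseq// suffix_subseq.
exists (b :: w1); split; first by rewrite vE subseq_nseq_cons.
move=> z Zz; have [m [t zE]] := first_occurrence (Zin z Zz).
by rewrite zE subseq_nseq_cons; apply: w1Z; exists m; rewrite -zE.
Qed.

Lemma cancellative_MacNeille (Z : set word) :
  upward_closed Z -> cancellative Z -> MacNeille Z.
Proof.
(* The family is that of all lower bounds of [Z]. *)
move=> upZ canZ; exists [set w | forall z, Z z -> subseq w z] => //.
apply/seteqP; split => v; last by move=> Zv w; apply.
move=> coneV; apply: contrapT => /(separating_lower_bound upZ canZ) [w [wv wZ]].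
by move/negP: wv; apply; exact: (coneV w wZ).
Qed.

(** * Walks and the zigzag distance *)

Definition step (G : digraph) (a : bool) (x y : G) : Prop :=
  if a then arc x y else arc y x.

Fixpoint walk (G : digraph) (u : word) (x y : G) : Prop :=
  if u is a :: u' then exists z, step a x z /\ walk u' z y else x = y.

Lemma step_refl (G : digraph) (a : bool) (x : G) : step a x x.
Proof. by case: a; apply: arc_refl. Qed.

Lemma step_flip (G : digraph) (a : bool) (x y : G) : step (~~ a) y x = step a x y.
Proof. by case: a. Qed.

Lemma zigzag_step (u : word) (i j : zigzag u) :
  j = i.+1 :> nat -> step (nth true u i) i j.
Proof. by rewrite /step /=; case E: nth => ji; [apply: Or32|apply: Or33]. Qed.

Lemma step_hom (G H : digraph) (f : G -> H) : is_hom f ->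
  forall a x y, step a x y -> step a (f x) (f y).
Proof. by move=> homf [] x y; apply: homf. Qed.

Lemma walk_hom (G H : digraph) (f : G -> H) : is_hom f ->
  forall u x y, walk u x y -> walk u (f x) (f y).
Proof.
move=> homf; elim=> [x y ->//|a u IHu x y /= [z [xz zy]]].
by exists (f z); split; [apply: step_hom|apply: IHu].
Qed.

(** Trades homomorphisms from zigzags for recursive walks, which are easily concatenated and
    reversed. *)
Lemma zdistE (G : digraph) (x y : G) : zdist x y = [set u | walk u x y].
Proof.
apply/seteqP; split => u /=.
- move=> [h [homh <- <-]]; elim: u h homh => [h _|a u IHu h homh].
    by congr h; apply: val_inj.
  exists (h (lift ord0 ord0)); split.
    exact: (step_hom homh (@zigzag_step (a :: u) ord0 (lift ord0 ord0) erefl)).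
  have -> : @ord_max (size (a :: u)) = lift ord0 (@ord_max (size u)).
    exact: val_inj.
  apply: (IHu (fun i : zigzag u => h (lift ord0 i))) => i j ij.
  apply: homh; case: ij => [->|[ij ui]|[ij ui]]; first exact: Or31.
    by apply: Or32; rewrite /= /bump !add1n ij.
  by apply: Or33; rewrite /= /bump !add1n ij.
- elim: u x => [x /= ->|a u IHu x /= [z [xz /IHu [h [homh h0 hmax]]]]].
    exists (fun=> y); split => // i j _; exact: arc_refl.
  (* [unlift ord0] is [None] exactly at vertex 0, which is sent to [x]; the other vertices follow
     [h], shifted by one. *)
  pose h' (i : zigzag (a :: u)) : G := oapp h x (@unlift (size u).+2 ord0 i).
  exists h'; rewrite /h'; split; last 2 first.
  - by rewrite unlift_none.
  - rewrite (_ : ord_max = lift ord0 (@ord_max (size u))) ?liftK//.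
    exact: val_inj.
  move=> i j ij.
  case: (unliftP ord0 i) ij => [i' ->|->]; case: (unliftP ord0 j) => [j' ->|->];
    rewrite ?liftK ?unlift_none /=.
  + move=> [/lift_inj ->|[]|[]]; first exact: arc_refl.
      by rewrite /= /bump !add1n => -[ji] ui; apply: homh; apply: Or32.
    by rewrite /= /bump !add1n => -[ji] ui; apply: homh; apply: Or33.
  + move=> [/eqP|[//]|[]]; first by rewrite eq_sym (negPf (neq_lift _ _)).
    rewrite /= /bump !add1n => -[i0] aF; rewrite aF in xz.
    by rewrite (_ : i' = ord0) ?h0//; apply: val_inj.
  + move=> [/eqP|[]|[//]]; first by rewrite (negPf (neq_lift _ _)).
    rewrite /= /bump !add1n => -[i0] aT; rewrite aT in xz.
    by rewrite (_ : j' = ord0) ?h0//; apply: val_inj.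
  + by move=> _; apply: arc_refl.
Qed.

Section Walks.
Variable G : digraph.
Implicit Types (x y z : G) (u v : word).

Lemma walk1 a x y : walk [:: a] x y <-> step a x y.
Proof. by split=> [[z [xz <-]]|xy]; [|exists y]. Qed.

Lemma walk_cat u v x y z : walk u x y -> walk v y z -> walk (u ++ v) x z.
Proof.
elim: u x => [x -> //|a u IHu x /= [t [xt ty]] yz].
by exists t; split=> //; apply: IHu.
Qed.

(** A loop can be read as either letter, so extra letters are spent standing still. *)
Lemma walk_subseq x y : upward_closed [set u | walk u x y].
Proof.
move=> u v; elim: v x u => [x u /eqP -> //|b v IHv x [|a u]] /=.
  move=> _ xy; exists x; split; first exact: step_refl.
  exact: (IHv x [::] (sub0seq _) xy).
case: eqVneq => [-> uv [z [xz zy]]|_ uv uxy].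
  by exists z; split=> //; apply: IHv zy.
exists x; split; [exact: step_refl|exact: (IHv _ _ uv)].
Qed.

Lemma walk_flip u x y : walk u x y -> walk (flip u) y x.
Proof.
elim: u x => [x -> //|a u IHu x /= [z [xz /IHu zy]]].
rewrite flip_cons; apply: walk_cat zy _.
by apply/walk1; rewrite step_flip.
Qed.

End Walks.

Lemma isometryP (G H : digraph) (f : G -> H) :
  isometry f <-> forall x y u, walk u (f x) (f y) <-> walk u x y.
Proof.
split=> [isof x y u|isof x y].
  by have := isof x y; rewrite !zdistE => /seteqP[sub1 sub2]; split=> [/sub1|/sub2].
by rewrite !zdistE; apply/seteqP; split=> u /isof.
Qed.

Lemma isometry_arc (G H : digraph) (f : G -> H) : isometry f ->
  forall x y, arc (f x) (f y) <-> arc x y.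
Proof.
move=> /isometryP isof x y; have [fxy xy] := isof x y [:: true].
by split=> h; apply/(@walk1 _ true); [apply: fxy|apply: xy]; apply/walk1.
Qed.

(** * Blow-up into an oriented graph *)

Lemma Cantor_collision (C : Type) (c : set C -> C) :
  exists A B a, [/\ c A = c B, A a & ~ B a].
Proof.
(* Cantor's diagonal set, to be tested at its own value [c D]. *)
pose D : set C := [set a | exists A, c A = a /\ ~ A a].
have [[A [cA nA]]|nD] := pselect (D (c D)).
  by exists D, A, (c D); split=> //; exists A.
by exfalso; apply: (nD); exists D.
Qed.

Section BlowUp.
Variables (G H : digraph) (f : G -> H).
Hypotheses (orG : oriented G) (isof : isometry f).

Let C : Type := H -> G.
Let tag : Type := option (set C + C).

(** Arcs between sets [inl A] and elements [inr a] record membership, so that Cantor's argument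
    applies; [None] tags the copy of [G]. *)
Definition tag_arc (s t : tag) : Prop :=
  match s, t with
  | None, Some (inl _) => True
  | Some (inr _), None => True
  | Some (inl A), Some (inr a) => A a
  | Some (inr a), Some (inl A) => ~ A a
  | _, _ => False
  end.

Lemma tag_arc_asym (s t : tag) : tag_arc s t -> ~ tag_arc t s.
Proof. by case: s t => [[A|a]|] [[B|b]|] //= ? ?. Qed.

(** One-way arcs of [H] join all copies of their ends; tags orient only the 2-cycles and loops. *)
Definition blowup_arc (p q : H * tag) : Prop :=
  p = q \/ arc p.1 q.1 /\ (~ arc q.1 p.1 \/ tag_arc p.2 q.2).

Lemma blowup_arc_refl (p : H * tag) : blowup_arc p p.
Proof. by left. Qed.

Definition blowup : digraph := Digraph blowup_arc_refl.

Lemma blowup_oriented : oriented blowup.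
Proof.
move=> p q [//|[pq pq2]] [//|[qp qp2]].
case: pq2 => // /tag_arc_asym; case: qp2 => //.
Qed.

Lemma fst_hom : @is_hom blowup H fst.
Proof. by move=> p q [->|[]//]; apply: arc_refl. Qed.

(** Walks project to [H]. Conversely, the image of [f] has no 2-cycle on distinct vertices, so its
    arcs persist between copies tagged [None]. *)
Lemma blowup_isometry : @isometry G blowup (fun x => (f x, None)).
Proof.
apply/isometryP => x y u; split.
  by move/(walk_hom fst_hom)/(proj1 (isometryP f) isof).
apply: (@walk_hom G blowup (fun x => (f x, None))) => {}x {}y xy.
have [->|nxy] := pselect (x = y); first by left.
right; split; first by apply/(isometry_arc isof).
by left=> /(isometry_arc isof)/(orG xy).
Qed.

Lemma blowup_retract (g : blowup -> G) :
  is_hom g -> (forall x, g (f x, None) = x) ->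
  exists k : H -> G, is_hom k /\ forall x, k (f x) = x.
Proof.
move=> homg gf.
have [A [B [a [cAB Aa nBa]]]] :=
  Cantor_collision (fun A : set C => (fun h => g (h, Some (inl A))) : C).
have arc_tag h h' s t : arc h h' -> tag_arc s t -> arc (g (h, s)) (g (h', t)).
  by move=> hh' st; apply: homg; right; split=> //; right.
(* The arcs from [inl A] to [inr a] and on to [inl B] become a 2-cycle in [G], as [g] agrees on the
   copies tagged by [A] and [B]. *)
have gAa h : g (h, Some (inl A)) = g (h, Some (inr a)).
  apply: orG; first exact/arc_tag/Aa/arc_refl.
  by rewrite [g (h, Some (inl A))](congr1 (@^~ h) cAB); apply/arc_tag/nBa/arc_refl.
exists (fun h => g (h, Some (inl A))); split.
  by move=> h h' hh'; rewrite [X in arc _ X]gAa; apply: arc_tag.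
(* [None] lies between [inr a] and [inl A], whose copies are already identified. *)
move=> x; rewrite -[RHS]gf; apply: orG; last exact/arc_tag/I/arc_refl.
by rewrite gAa; apply/arc_tag/I/arc_refl.
Qed.

End BlowUp.

Lemma retract_of_isometric_extension (G : digraph) :
  oriented G -> absolute_retract G ->
  forall (H : digraph) (f : G -> H), isometry f ->
  exists k : H -> G, is_hom k /\ forall x, k (f x) = x.
Proof.
move=> orG arG H f isof.
have [g [homg gf]] := arG _ (@blowup_oriented G H) _ (blowup_isometry orG isof).
exact: blowup_retract homg gf.
Qed.

(** * The graph of profiles *)

Section Profiles.
Variable G : digraph.

(* A profile prescribes, for each [t], the set of words allowed from [t] to a
   virtual vertex. *)
Record profile : Type := Profile {
  words :> G -> set word;
  words_up : forall t, upward_closed (words t)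
}.

Lemma profile_ext (phi psi : profile) :
  (forall t w, phi t w <-> psi t w) -> phi = psi.
Proof.
case: phi psi => [phi phiup] [psi psiup] /= phipsi.
have E : phi = psi by apply/funext => t; apply/seteqP; split=> w /phipsi.
by rewrite {}E in phiup phipsi *; congr Profile; apply: Prop_irrelevance.
Qed.

Definition generated_words (L : G -> set word) (t : G) : set word :=
  [set w | exists2 w0, L t w0 & subseq w0 w].

Lemma generated_words_up (L : G -> set word) (t : G) :
  upward_closed (generated_words L t).
Proof.
by move=> w w' ww' [w0 Lw0 w0w]; exists w0 => //; apply: subseq_trans ww'.
Qed.

Definition generated (L : G -> set word) : profile :=
  Profile (@generated_words_up L).

(** The conditions that a walk [u] from [phi] to [psi] forces on their words; [walk_linked] shows
    that they suffice. *)
Definition linked (u : word) (phi psi : profile) : Prop :=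
  forall t w, (phi t w -> psi t (w ++ u)) /\ (psi t w -> phi t (w ++ flip u)).

Lemma linked_refl (u : word) (phi : profile) : linked u phi phi.
Proof. by move=> t w; split; apply/words_up/prefix_subseq. Qed.

Lemma linked_cat (u v : word) (phi chi psi : profile) :
  linked u phi chi -> linked v chi psi -> linked (u ++ v) phi psi.
Proof.
move=> uP vP t w; split; first by move=> /(uP _ _).1/(vP _ _).1; rewrite catA.
by move=> /(vP _ _).2/(uP _ _).2; rewrite flip_cat catA.
Qed.

Definition profile_graph : digraph :=
  @Digraph profile (linked [:: true]) (linked_refl [:: true]).

Lemma linked_step (a : bool) (phi psi : profile_graph) :
  linked [:: a] phi psi <-> step a phi psi.
Proof.
case: a => //=; split=> l t w; have [l1 l2] := l t w; split.
- exact: l2.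
- exact: l1.
- exact: l2.
- exact: l1.
Qed.

Lemma walk_linked (u : word) (phi psi : profile_graph) :
  walk u phi psi <-> linked u phi psi.
Proof.
split.
  elim: u phi => [phi ->|a u IHu phi /= [chi [/linked_step pc /IHu cp]]].
    exact: linked_refl.
  exact: (linked_cat pc cp).
elim: u phi => [phi l|a u IHu phi l].
  apply: profile_ext => t w; have [] := l t w; rewrite /flip /= !cats0.
  by split.
(* The least profile with the words forced by a step [a] from [phi] and by the reversed walk [u]
   from [psi]. *)
pose chi := generated (fun t => [set w |
  (exists2 w0, phi t w0 & w = w0 ++ [:: a]) \/
  (exists2 w0, psi t w0 & w = w0 ++ flip u)]).
exists (chi : profile_graph); split.
  apply/linked_step => t w; split.
    by move=> pw; exists (w ++ [:: a]) => //; left; exists w.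
  move=> [_ [[w0 pw0 ->]|[w0 pw0 ->]] w0w].
    apply: words_up pw0; apply: subseq_trans (prefix_subseq _ _).
    exact: subseq_trans (prefix_subseq _ _) w0w.
  have := (l t w0).2 pw0; apply: words_up.
  by rewrite flip_cons catA; apply: cat_subseq.
apply: IHu => t w; split; last first.
  by move=> pw; exists (w ++ flip u) => //; right; exists w.
move=> [_ [[w0 pw0 ->]|[w0 pw0 ->]] w0w].
  have := (l t w0).1 pw0; apply: words_up.
  by rewrite -cat1s catA; apply: cat_subseq.
apply: words_up pw0; apply: subseq_trans (prefix_subseq _ _).
exact: subseq_trans (prefix_subseq _ _) w0w.
Qed.

(** A Yoneda-type embedding; its isometry follows by evaluating at the source and the empty word. *)
Definition point (x : G) : profile_graph :=
  @Profile (fun t => [set w | walk w t x]) (fun t => @walk_subseq G t x).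

Lemma point_isometry : isometry point.
Proof.
apply/isometryP => x y u; split.
  by move/walk_linked => l; apply: ((l x [::]).1 _).
move=> uxy; apply/walk_linked => t w; split=> wt; apply: walk_cat wt _ => //.
exact: walk_flip.
Qed.

End Profiles.

(** * Cancellation in an absolute retract *)

Lemma absolute_retract_cancellative (G : digraph) :
  oriented G -> absolute_retract G ->
  forall x y : G, cancellative [set u | walk u x y].
Proof.
move=> orG arG x y u v /= uTv uFv.
have uv a : walk (u ++ a :: v) x y by case: a.
have vu a : walk (flip v ++ a :: flip u) y x.
  have := walk_flip (uv (~~ a)).
  by rewrite flip_cat flip_cons negbK -catA.
have [k [homk kp]] := retract_of_isometric_extension orG arG (@point_isometry G).
(* [p] is reached from [x] by [u], or from [y] by [flip v] and then a step from [q], of either sign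
   since [p] and [q] are to form a 2-cycle; [q] is symmetric. *)
pose p : profile_graph G := generated (fun t => [set w |
  (exists2 w0, walk w0 t x & w = w0 ++ u) \/
  (exists2 w0, walk w0 t y & exists a, w = w0 ++ flip v ++ [:: a])]).
pose q : profile_graph G := generated (fun t => [set w |
  (exists2 w0, walk w0 t x & exists a, w = w0 ++ u ++ [:: a]) \/
  (exists2 w0, walk w0 t y & w = w0 ++ flip v)]).
have xp : walk u (point x) p.
  apply/walk_linked => t w; split.
    by move=> wt; exists (w ++ u) => //; left; exists w.
  move=> [_ [[w0 wt ->]|[w0 wt [a ->]]] w0w].
    apply: walk_subseq wt; apply: subseq_trans (prefix_subseq _ _).
    exact: subseq_trans (prefix_subseq _ _) w0w.
  (* The extra letter [a] is arbitrary, so both hypotheses of the cancellation rule are needed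
     here. *)
  apply: walk_subseq (walk_cat wt (vu a)).
  by rewrite -[a :: _]cat1s !catA -[(w0 ++ _) ++ _]catA; apply: cat_subseq.
have qy : walk v q (point y).
  apply/walk_linked => t w; split; last first.
    by move=> wt; exists (w ++ flip v) => //; right; exists w.
  move=> [_ [[w0 wt [a ->]]|[w0 wt ->]] w0w].
    apply: walk_subseq (walk_cat wt (uv a)).
    by rewrite -[a :: _]cat1s !catA -[(w0 ++ _) ++ _]catA; apply: cat_subseq.
  apply: walk_subseq wt; apply: subseq_trans (prefix_subseq _ _).
  exact: subseq_trans (prefix_subseq _ _) w0w.
have pq a : step a p q.
  apply/linked_step => t w; split.
    move=> [_ [[w0 wt ->]|[w0 wt [b ->]]] w0w].
      exists ((w0 ++ u) ++ [:: a]); last exact: cat_subseq.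
      by left; exists w0 => //; exists a; rewrite catA.
    exists (w0 ++ flip v); first by right; exists w0.
    apply: subseq_trans (prefix_subseq _ _); apply: subseq_trans w0w.
    by rewrite catA prefix_subseq.
  move=> [_ [[w0 wt [b ->]]|[w0 wt ->]] w0w].
    exists (w0 ++ u); first by left; exists w0.
    apply: subseq_trans (prefix_subseq _ _); apply: subseq_trans w0w.
    by rewrite catA prefix_subseq.
  exists ((w0 ++ flip v) ++ [:: ~~ a]); last exact: cat_subseq.
  by right; exists w0 => //; exists (~~ a); rewrite catA.
have kpq : k p = k q.
  by apply: orG; apply: homk; [apply: (pq true)|apply: (pq false)].
have := walk_hom homk qy; rewrite kp -kpq; apply: walk_cat.
by have := walk_hom homk xp; rewrite kp.
Qed.

Theorem theorem5p2 (G : digraph) (orG : oriented G) (arG : absolute_retract G)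
    (x y : G) : MacNeille (zdist x y).
Proof.
rewrite zdistE; apply: cancellative_MacNeille; first exact: walk_subseq.
exact: absolute_retract_cancellative.
Qed.
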